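(* Let $I\subset\mathbb{R}$ be a closed interval and let $\Phi:I\to\mathbb{R}$ be a smooth convex function such that $(u,v)\mapsto\Phi''(u)v^2$ is non-negative and convex on $I\times I$. Let $\mathcal{E}^\Phi$ be a functional (depending on $\Phi$ and its derivatives) that associates to each smooth $f:\mathbb{R}^d\to I$ a non-negative measurable function $\mathcal{E}^\Phi(f)$ on $\mathbb{R}^d$ and that commutes with translations: $\mathcal{E}^\Phi(\tau_x\cdot f)=\tau_x\cdot\mathcal{E}^\Phi(f)$ for all $x\in\mathbb{R}^d$. For each $i\in\{1,\dots,n\}$ let $\mu_i$ be a probability measure on $\mathbb{R}^d$ for which there is $c_i>0$ such that for every smooth $f:\mathbb{R}^d\to I$, $$\mathrm{Ent}^\Phi_{\mu_i}(f)\le c_i\int\mathcal{E}^\Phi(f)\,d\mu_i .$$ Then for every smooth $f:\mathbb{R}^d\to I$, $$\mathrm{Ent}^\Phi_{\mu_1*\cdots*\mu_n}(f)\le(c_1+\cdots+c_n)\int\mathcal{E}^\Phi(f)\,d(\mu_1*\cdots*\mu_n).$$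
   Context: For a probability measure $\mu$ and a $\mu$-integrable $f$ with values in $I$, $\mathrm{Ent}^\Phi_\mu(f):=\int\Phi(f)\,d\mu-\Phi\big(\int f\,d\mu\big)\in[0,+\infty]$; the functional is only considered on integrable functions. For $x\in\mathbb{R}^d$ and a function $f$ on $\mathbb{R}^d$, $(\tau_x\cdot f)(y):=f(x+y)$. The symbol $*$ denotes convolution of measures. *)

(* Defs.v *)
From HB Require Import structures.
From mathcomp Require Import all_boot all_order all_algebra.
From mathcomp Require Import lra.
From mathcomp Require Import all_classical all_reals all_analysis. 
From mathcomp Require Import measurable_realfun.

Set Implicit Arguments.
Unset Strict Implicit.
Unset Printing Implicit Defensive.

Import Order.TTheory GRing.Theory Num.Theory.
Import numFieldNormedType.Exports.

Local Open Scope classical_set_scope.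
Local Open Scope ring_scope.

(* The library has no sigma-algebra on row vectors; this is the Borel one. *)
Section borel_rV.
Variables (R : realType) (d : nat).
Let G := @open 'rV[R]_d.

HB.instance Definition _ := @isMeasurable.Build (sigma_display G) 'rV[R]_d
  <<s G >> (@sigma_algebra0 _ setT G) (@sigma_algebraC _ G)
  (@sigma_algebra_bigcup _ setT G).

End borel_rV.

Section vector_addition.
Context {R : realType} {d : nat}.

Definition add_rV (p : 'rV[R]_d * 'rV[R]_d) : 'rV[R]_d := p.1 + p.2.

Lemma open_measurable_rV (U : set 'rV[R]_d) : open U -> measurable U.
Proof. exact: sub_gen_smallest. Qed.

Lemma rat_rV_dense (x : 'rV[R]_d) (r : R) : 0 < r ->
  exists a : 'rV[rat]_d, ball (map_mx (@ratr R) a) r x.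
Proof.
move=> r0.
have H (i : 'I_d) : {q : rat | ball (ratr q : R) r (x ord0 i)}.
  apply: cid; have /rat_in_itvoo[q] : x ord0 i - r < x ord0 i + r.
    by rewrite ltrD2l gtrN.
  rewrite in_itv/= => /andP[q1 q2]; exists q.
  by rewrite /ball/= ltr_distl q1 q2.
exists (\row_i sval (H i)); split => // i j.
by rewrite !mxE (ord1 i); exact: (svalP (H j)).
Qed.

Lemma measurable_add_rV : measurable_fun setT add_rV.
Proof.
apply: (@measurability _ _ _ _ setT _ (@open 'rV[R]_d)) => //.
move=> _ [U oU <-]; rewrite setTI.
pose B (q : 'rV[rat]_d * 'rV[rat]_d * nat) : set ('rV[R]_d * 'rV[R]_d) :=
  ball (map_mx (@ratr R) q.1.1) q.2.+1%:R^-1 `*`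
  ball (map_mx (@ratr R) q.1.2) q.2.+1%:R^-1.
pose F q := if pselect (B q `<=` add_rV @^-1` U) then B q else set0.
have -> : add_rV @^-1` U = \bigcup_q F q.
  apply/seteqP; split=> [[x y]/= Uxy|p [q _]]; last first.
    by rewrite /F; case: pselect => // sub; exact: sub.
  have /nbhs_ballP[e /= e0 He] : nbhs (x + y) U by exact: open_nbhs_nbhs.
  have e40 : 0 < e / 4 by rewrite divr_gt0.
  have [k _ /(_ k (leqnn k)) ke] := near_infty_natSinv_lt (PosNum e40).
  set r : R := k.+1%:R^-1 in ke.
  have r0 : 0 < r by rewrite invr_gt0.
  have [a ax] := rat_rV_dense x r0; have [b yb] := rat_rV_dense y r0.
  exists (a, b, k) => //; rewrite /F; case: pselect => [?|[]].
    by split.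
  move=> -[x' y'] [/= ax' by'] /=; apply: He.
  have xx' : ball x (r + r) x' by exact: ball_triangle (ball_sym ax) ax'.
  have yy' : ball y (r + r) y' by exact: ball_triangle (ball_sym yb) by'.
  rewrite -!ball_normE/= in xx' yy' *.
  rewrite opprD addrACA (le_lt_trans (ler_normD _ _))//.
  apply: lt_trans (ltrD xx' yy') _.
  have {}ke : r < e / 4 by exact: ke.
  by clearbody r; lra.
apply: countable_bigcupT_measurable; first exact: countableP.
move=> q; rewrite /F; case: pselect => [?|?]; last exact: measurable0.
by apply: measurableX; apply: open_measurable_rV; exact: ball_open.
Qed.

HB.instance Definition _ :=
  isMeasurableFun.Build _ _ _ _ add_rV measurable_add_rV.

End vector_addition.

Section convolution.
Context {R : realType} {d : nat}.

Definition convolution (mu nu : probability 'rV[R]_d R) :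
    probability 'rV[R]_d R :=
  distribution (mu \x nu)%E add_rV.

(* The Dirac mass at 0 is the neutral element of convolution. *)
Definition convolutions (n : nat) (mu : 'I_n -> probability 'rV[R]_d R) :
    probability 'rV[R]_d R :=
  \big[convolution/(\d_(0 : 'rV[R]_d) : probability 'rV[R]_d R)]_(i < n) mu i.

End convolution.

Section smoothness.
Context {R : realType}.

Definition partial (d : nat) (i : 'I_d) (f : 'rV[R]_d -> R) : 'rV[R]_d -> R :=
  'D_(delta_mx ord0 i) f.

(* C^oo: all iterated partial derivatives exist and are continuous. *)
Definition smooth (d : nat) (f : 'rV[R]_d -> R) : Prop :=
  forall s : seq 'I_d,
    let g := foldr (@partial d) f s in
    continuous g /\ forall i x, derivable g x (delta_mx ord0 i).

(* Derivatives relative to a set: at an endpoint of an interval they are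
   one-sided, and only the values of g on I matter. *)
Definition difference_quotient (g : R -> R) (u w : R) : R :=
  (g w - g u) / (w - u).

Definition derivable_in (I : set R) (g : R -> R) (u : R) : Prop :=
  cvg (difference_quotient g u @ within I u^').

Definition derive_in (I : set R) (g : R -> R) (u : R) : R :=
  lim (difference_quotient g u @ within I u^').

Definition smooth_in (I : set R) (g : R -> R) : Prop :=
  forall (k : nat) (u : R), I u -> derivable_in I (iter k (derive_in I) g) u.

(* (u, v) |-> Phi''(u) v^2 *)
Definition second_order_form (I : set R) (Phi : R -> R) (p : R * R) : R :=
  derive_in I (derive_in I Phi) p.1 * p.2 ^+ 2.

End smoothness.

Definition translate (R : realType) (d : nat) (T : Type) (x : 'rV[R]_d)
  (f : 'rV[R]_d -> T) : 'rV[R]_d -> T := fun y => f (x + y).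

(* For convex Phi and integrable f the negative part of Phi \o f is integrable,
   so the first term is well defined in ]-oo, +oo]. *)
Definition entropy {disp : measure_display} {T : measurableType disp}
    {R : realType} (Phi : R -> R) (mu : probability T R) (f : T -> R) :
    \bar R :=
  (\int[mu]_x (Phi (f x))%:E - (Phi (\int[mu]_x f x)%R)%:E)%E.

(* Main.v *)
(* Let D(u, v) = Phi u - Phi v - Phi'(v) (u - v), so that Ent_P(f) is the
   integral of D(f, m), where m is the P-mean of f. Convexity of Phi''(u) v^2
   makes D jointly convex: along a segment, the second derivative of D is the
   gap between Phi''(u) v^2 and one of its tangent planes.
   Let F be a function on a product, with means m (over x) and M. For each v,
   the integral of D(f, v) is Ent_P(f) + D(m, v), hence Ent_(P x Q)(F) is the
   Q-mean of the entropies of F(., y) plus the Q-mean of D(m(y), M). By Jensen's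
   inequality for D, applied to (F(x, y), k(x)) with k(x) the mean of F(x, .),
   the latter is at most the P-mean of the entropies of F(x, .).
   For F(x, y) = f(x + y) the sections are translates of f, so the inequalities
   for P and Q add up to one for P * Q. *)

Require Import Defs.
From mathcomp Require Import all_boot all_order all_algebra.
From mathcomp Require Import ring lra.
From mathcomp Require Import all_classical all_reals all_analysis.
From mathcomp Require Import measurable_realfun.
Import Order.TTheory GRing.Theory Num.Theory.
Import numFieldNormedType.Exports.
Local Open Scope classical_set_scope.
Local Open Scope ring_scope.

(** * Derivatives relative to an interval *)

Section derivative_in.
Context {R : realType}.
Implicit Types (I J : set R) (g h : R -> R) (u l : R).

(* Caratheodory's form of [derive_in I g u = l]; it makes no claim when [u] is
   isolated in [I]. *)
Definition has_derive_in I g u l : Prop :=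
  exists s : R -> R, s w @[w --> within I (nbhs u)] --> l /\
    forall w, I w -> g w = g u + s w * (w - u).

Lemma smooth_in_has_derive I g k u : smooth_in I g -> I u ->
  has_derive_in I (iter k (derive_in I) g) u (iter k.+1 (derive_in I) g u).
Proof.
move=> Ig Iu; have /= := Ig k u Iu.
rewrite -[derive_in I (iter k (derive_in I) g) u]/(iter k.+1 (derive_in I) g u).
set G := iter k _ g; set l := iter _ _ _ _ => cvgq.
have {}cvgq : difference_quotient G u @ within I u^' --> l by exact: cvgq.
(* The difference quotient is controlled only on the punctured neighbourhood; giving the slope the
   value [l] at [u] makes it converge along the full filter. *)
exists (fun w => if w == u then l else difference_quotient G u w); split.
  move=> A lA.
  have qA : \forall w \near u, w != u -> I w -> A (difference_quotient G u w).
    exact: cvgq A lA.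
  suff : \forall w \near u, I w ->
    A (if w == u then l else difference_quotient G u w) by [].
  apply: filterS qA => w qw Iw; case: eqP => [_|/eqP wu]; last exact: qw.
  exact: nbhs_singleton.
move=> w Iw; case: eqP => [->|/eqP wu]; first by rewrite subrr mulr0 addr0.
by rewrite /difference_quotient divfK ?subr_eq0// addrC subrK.
Qed.

Lemma has_derive_in_cvg {I g u l} : has_derive_in I g u l ->
  g w @[w --> within I (nbhs u)] --> g u.
Proof.
move=> [s [sl gE]].
have : g u + s w * (w - u) @[w --> within I (nbhs u)] --> g u + l * (u - u).
  apply: cvgD; first exact: cvg_cst.
  apply: cvgM => //; apply: cvgB; last exact: cvg_cst.
  exact: cvg_within.
rewrite subrr mulr0 addr0; apply: cvg_trans; apply: near_eq_cvg.
by apply: filterS (withinT I _) => w Iw /=; rewrite (gE _ Iw).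
Qed.

Lemma has_derive_in_cst I u (a : R) : has_derive_in I (fun=> a) u 0.
Proof.
by exists (fun=> 0); split=> [|w _]; [exact: cvg_cst|rewrite mul0r addr0].
Qed.

Lemma has_derive_inD {I g h u l m} : has_derive_in I g u l ->
  has_derive_in I h u m -> has_derive_in I (fun w => g w + h w) u (l + m).
Proof.
move=> [s [sl gE]] [t [tm hE]]; exists (fun w => s w + t w); split.
  exact: cvgD.
by move=> w Iw; rewrite (gE _ Iw) (hE _ Iw); ring.
Qed.

Lemma has_derive_inN {I g u l} : has_derive_in I g u l ->
  has_derive_in I (fun w => - g w) u (- l).
Proof.
move=> [s [sl gE]]; exists (fun w => - s w); split; first exact: cvgN.
by move=> w Iw; rewrite (gE _ Iw); ring.
Qed.

Lemma has_derive_inM {I g h u l m} : has_derive_in I g u l ->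
  has_derive_in I h u m ->
  has_derive_in I (fun w => g w * h w) u (l * h u + g u * m).
Proof.
move=> gl hm; have gc := has_derive_in_cvg gl.
move: gl hm => [s [sl gE]] [t [tm hE]].
exists (fun w => s w * h u + g w * t w); split.
  apply: cvgD; apply: cvgM => //; exact: cvg_cst.
by move=> w Iw; rewrite (hE _ Iw) mulrDr {1}(gE _ Iw); ring.
Qed.

Lemma has_derive_in_affine I (a x u : R) :
  has_derive_in I (fun t => a + t * x) u x.
Proof.
by exists (fun=> x); split=> [|w _]; [exact: cvg_cst|ring].
Qed.

(** The slope is multiplied by [x] and never divided by it, so [x = 0], a segment reduced to a
    point, is covered. *)
Lemma has_derive_in_comp_affine {I J g} {a x u l : R} :
  (forall t, J t -> I (a + t * x)) -> J u ->
  has_derive_in I g (a + u * x) l ->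
  has_derive_in J (fun t => g (a + t * x)) u (l * x).
Proof.
move=> JI Ju [s [sl gE]]; exists (fun t => s (a + t * x) * x); split.
  apply: cvgM; last exact: cvg_cst.
  apply: cvg_comp sl => A IA.
  have {}IA : \forall w \near a + u * x, I w -> A w by [].
  have : a + t * x @[t --> u] --> a + u * x.
    by apply: cvgD; [exact: cvg_cst|apply: cvgM => //; exact: cvg_cst].
  move=> /(_ _ IA) H.
  have {}H : \forall t \near u, I (a + t * x) -> A (a + t * x) by exact: H.
  suff : \forall t \near u, J t -> A (a + t * x) by [].
  by apply: filterS H => t Ht Jt; apply: Ht; exact: JI.
by move=> w Jw; rewrite (gE _ (JI _ Jw)); ring.
Qed.

(** [[a, b]] is a neighbourhood of each point of []a, b[], so relative and ordinary limits agree
    there. *)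
Lemma has_derive_in_is_derive {a b : R} {h u l} : u \in `]a, b[ ->
  has_derive_in `[a, b] h u l -> is_derive u 1 h l.
Proof.
move=> uab [s [sl hE]]; apply/is_derive1_caratheodory.
exists (fun z => if z == u then l else (h z - h u) / (z - u)); split.
- move=> z; case: eqP => [->|/eqP zu]; first by rewrite !subrr mulr0.
  by rewrite divfK// subr_eq0.
- apply/continuous_withinNx; rewrite eqxx.
  have nab : \forall z \near u, z \in `[a, b].
    near=> z; apply: subset_itv_oo_cc; near: z; exact: near_in_itvoo.
  have sl' : s @ u^' --> l.
    move=> A /sl sA.
    have {}sA : \forall z \near u, z \in `[a, b] -> A (s z) by exact: sA.
    suff : \forall z \near u, z != u -> A (s z) by [].
    by apply: filterS2 nab sA => z zab sz _; exact: sz.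
  apply: cvg_trans sl'; apply: near_eq_cvg.
  suff : \forall z \near u, z != u ->
    s z = (if z == u then l else (h z - h u) / (z - u)) by [].
  apply: filterS nab => z zab zu.
  by rewrite (negbTE zu) (hE z) // addrAC subrr add0r mulfK// subr_eq0.
- by rewrite eqxx.
Unshelve. all: by end_near.
Qed.

Lemma has_derive_in_continuous {I} {h h' : R -> R} :
  (forall t, I t -> has_derive_in I h t (h' t)) -> {within I, continuous h}.
Proof.
move=> hh'; apply/subspace_continuousP => t It.
exact: has_derive_in_cvg (hh' _ It).
Qed.

End derivative_in.

(** * One-variable calculus on the unit interval *)

Section unit_interval.
Context {R : realType}.
Implicit Types (h k : R -> R) (l : R).

Lemma has_derive_in_eq (I : set R) h (u l m : R) :
  has_derive_in I h u l -> l = m -> has_derive_in I h u m.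
Proof. by move=> ? <-. Qed.

(** Mean value theorem on [[0, a]]: relative derivatives are ordinary ones inside and still give
    continuity up to the endpoints. *)
Lemma derive_ge0_le h (h' : R -> R) (a : R) : 0 <= a <= 1 ->
  (forall t, 0 <= t <= 1 -> has_derive_in `[0, 1] h t (h' t)) ->
  (forall t, 0 <= t <= 1 -> 0 <= h' t) -> h 0 <= h a.
Proof.
move=> a01 hh' h'0; have h01 t : `[0, 1]%classic t -> 0 <= t <= 1.
  by rewrite /= in_itv.
have ch : {within `[0, 1], continuous h}.
  by apply: (@has_derive_in_continuous _ _ _ h') => t /h01; exact: hh'.
have a0 : 0 <= a by lra.
have sub : `[0, a]%classic `<=` (`[0, 1]%classic : set R).
  by move=> t; rewrite /= !in_itv/=; lra.
have dh t : t \in `]0, a[%R -> is_derive t 1 h (h' t).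
  rewrite in_itv/= => ta; apply: (has_derive_in_is_derive (a := 0) (b := 1)).
    by rewrite in_itv/=; lra.
  by apply: hh'; lra.
have [c] := MVT_segment a0 dh (continuous_subspaceW sub ch).
rewrite in_itv/= subr0 => ca hE.
by rewrite -subr_ge0 hE mulr_ge0// h'0//; lra.
Qed.

(** [h t - t * h' 0] has derivative [h' t - h' 0], which is nonnegative since [h'] never drops below
    its value at 0; compare the values at 0 and 1. *)
Lemma tangent_below h (h' h'' : R -> R) :
  (forall t, 0 <= t <= 1 -> has_derive_in `[0, 1] h t (h' t)) ->
  (forall t, 0 <= t <= 1 -> has_derive_in `[0, 1] h' t (h'' t)) ->
  (forall t, 0 <= t <= 1 -> 0 <= h'' t) -> h 0 + h' 0 <= h 1.
Proof.
move=> hh' h'h'' h''0.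
have h'_ge t : 0 <= t <= 1 -> h' 0 <= h' t.
  by move=> t01; exact: derive_ge0_le h'h'' h''0.
have hN t : 0 <= t <= 1 ->
    has_derive_in `[0, 1] (fun t => h t + (0 + t * - h' 0)) t (h' t + - h' 0).
  move=> t01; apply: has_derive_inD (hh' _ t01) _.
  exact: has_derive_in_affine.
have : h 0 + (0 + 0 * - h' 0) <= h 1 + (0 + 1 * - h' 0).
  by apply: derive_ge0_le hN _; [lra|move=> t /h'_ge; rewrite subr_ge0].
lra.
Qed.

(** The slope of [h] from 0 to a point of []0, 1[] is at most [C]; let the point tend to 0. *)
Lemma has_derive_in_le h l (C : R) : has_derive_in `[0, 1] h 0 l ->
  (forall t, 0 <= t <= 1 -> h t <= h 0 + t * C) -> l <= C.
Proof.
move=> [s [sl hE]] hC.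
have sl' : s @ (0 : R)^'+ --> l.
  move=> A /sl sA.
  have {}sA : \forall z \near (0 : R), `[0, 1]%classic z -> A (s z).
    exact: sA.
  have z1 : \forall z \near (0 : R), z < 1 by exact: lt_nbhsl.
  suff : \forall z \near (0 : R), 0 < z -> A (s z) by [].
  by apply: filterS2 z1 sA => z z1 + z0; apply; rewrite /= in_itv/=; lra.
apply: (cvgr_to_le sl'); near=> z.
have z0 : 0 < z by near: z; exact: nbhs_right_gt.
have z1 : z < 1 by near: z; exact: nbhs_right_lt.
have z01 : 0 <= z <= 1 by lra.
have := hC z z01; rewrite (hE z) ?subr0 ?lerD2l; last by rewrite /= in_itv.
by rewrite mulrC ler_pM2l.
Unshelve. all: by end_near.
Qed.

(** Adding the tangent inequalities of [k] at 0 and at [t] gives [k' 0 <= k' t], so the slopes of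
    [k'] at 0 are nonnegative. *)
Lemma convex_second_derivative_ge0 {k} {k' : R -> R} {l} :
  (forall t, 0 <= t <= 1 -> has_derive_in `[0, 1] k t (k' t)) ->
  has_derive_in `[0, 1] k' 0 l ->
  (forall a b t, 0 <= a <= 1 -> 0 <= b <= 1 -> 0 <= t <= 1 ->
     k (t * a + (1 - t) * b) <= t * k a + (1 - t) * k b) -> 0 <= l.
Proof.
move=> kk' k'l kconv.
have tangent a b : 0 <= a <= 1 -> 0 <= b <= 1 -> k' a * (b - a) <= k b - k a.
  move=> a01 b01.
  apply: (@has_derive_in_le (fun t => k (a + t * (b - a)))).
    apply: (@has_derive_in_comp_affine _ `[0, 1]).
    - by move=> t /=; rewrite !in_itv/=; nra.
    - by rewrite /= in_itv/=; lra.
    - by rewrite mul0r addr0; exact: kk'.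
  move=> t t01; have := kconv b a t b01 a01 t01.
  rewrite mul0r addr0; have -> : t * b + (1 - t) * a = a + t * (b - a) by ring.
  lra.
suff : - l <= 0 by rewrite oppr_le0.
apply: (@has_derive_in_le (fun w => - k' w)) (has_derive_inN k'l) _ => t t01.
rewrite mulr0 addr0 lerN2.
have [->//|t0] := eqVneq t 0.
have T1 := tangent 0 t _ t01; have T2 := tangent t 0 t01.
have {T1 T2} : (k' 0 - k' t) * t <= 0.
  by have := T1 ltac:(lra); have := T2 ltac:(lra); lra.
by rewrite pmulr_lle0 ?subr_le0//; lra.
Qed.

End unit_interval.

(** * Joint convexity of the Bregman divergence *)

Section bregman.
Context {R : realType} (I : set R) (I_itv : is_interval I).

Lemma interval_affine {a b t : R} : I a -> I b -> 0 <= t <= 1 ->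
  I (a + t * (b - a)).
Proof.
move=> Ia Ib t01; have [ab|ba] := leP a b.
  by apply: (I_itv _ _ Ia Ib); nra.
by apply: (I_itv _ _ Ib Ia); nra.
Qed.

Context (g g1 g2 : R -> R)
  (gg1 : forall u, I u -> has_derive_in I g u (g1 u))
  (g1g2 : forall u, I u -> has_derive_in I g1 u (g2 u)).

Let in01 (t : R) : `[0, 1]%classic t -> 0 <= t <= 1.
Proof. by rewrite /= in_itv. Qed.

Let in01' (t : R) : 0 <= t <= 1 -> `[0, 1]%classic t.
Proof. by rewrite /= in_itv. Qed.

Let comp_derive {f f' : R -> R} {v u t : R} :
  (forall w, I w -> has_derive_in I f w (f' w)) -> I v -> I u -> 0 <= t <= 1 ->
  has_derive_in `[0, 1] (fun s => f (v + s * (u - v))) t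
    (f' (v + t * (u - v)) * (u - v)).
Proof.
move=> ff' Iv Iu t01; apply: (@has_derive_in_comp_affine _ I).
- by move=> s /in01; exact: interval_affine.
- exact: in01'.
- by apply: ff'; exact: interval_affine.
Qed.

(** [form1] and [form2] are the first two derivatives of the form [g u * b ^+ 2] along the line
    through [(v, b)] with direction [(u - v, y)]. In the application [g] is Phi''. *)
Let form1 (v u b y s : R) : R :=
  g1 (v + s * (u - v)) * (u - v) * ((b + s * y) * (b + s * y)) +
  g (v + s * (u - v)) * (y * (b + s * y) + (b + s * y) * y).

Let form2 (v u b y s : R) : R :=
  g2 (v + s * (u - v)) * (u - v) ^+ 2 * (b + s * y) ^+ 2 +
  4 * (g1 (v + s * (u - v)) * (u - v) * (b + s * y) * y) +
  2 * (g (v + s * (u - v)) * y ^+ 2).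

Let form_derive1 v u b y t : I v -> I u -> 0 <= t <= 1 ->
  has_derive_in `[0, 1]
    (fun s => g (v + s * (u - v)) * ((b + s * y) * (b + s * y))) t
    (form1 v u b y t).
Proof.
move=> Iv Iu t01; apply: has_derive_in_eq.
  apply: has_derive_inM (comp_derive gg1 Iv Iu t01) _.
  by apply: has_derive_inM; exact: has_derive_in_affine.
by rewrite /form1; ring.
Qed.

Let form_derive2 v u b y t : I v -> I u -> 0 <= t <= 1 ->
  has_derive_in `[0, 1] (form1 v u b y) t (form2 v u b y t).
Proof.
move=> Iv Iu t01; apply: has_derive_in_eq.
  apply: has_derive_inD.
    apply: has_derive_inM.
      apply: has_derive_inM (comp_derive g1g2 Iv Iu t01) _.
      exact: has_derive_in_cst.
    by apply: has_derive_inM; exact: has_derive_in_affine.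
  apply: has_derive_inM (comp_derive gg1 Iv Iu t01) _.
  apply: has_derive_inD; apply: has_derive_inM;
    (exact: has_derive_in_affine || exact: has_derive_in_cst).
by rewrite /form2; ring.
Qed.

Hypothesis form_convex : forall u v b c t : R, I u -> I v -> I b -> I c ->
  0 <= t <= 1 -> g (t * u + (1 - t) * v) * (t * b + (1 - t) * c) ^+ 2 <=
    t * (g u * b ^+ 2) + (1 - t) * (g v * c ^+ 2).

(** Restricted to the segment from [(v, b)] to [(u, c)], the form is a convex function on [[0, 1]];
    take its second derivative at 0. *)
Let form2_ge0 v u b c : I v -> I u -> I b -> I c ->
  0 <= form2 v u b (c - b) 0.
Proof.
move=> Iv Iu Ib Ic; have zero01 : 0 <= (0 : R) <= 1 by lra.
apply: (convex_second_derivative_ge0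
  (fun t t01 => form_derive1 v u b (c - b) t Iv Iu t01)
  (form_derive2 v u b (c - b) 0 Iv Iu zero01)).
move=> r s t r01 s01 t01.
have := form_convex _ _ _ _ _ (interval_affine Iv Iu r01)
  (interval_affine Iv Iu s01)
  (interval_affine Ib Ic r01) (interval_affine Ib Ic s01) t01.
rewrite -!expr2; congr (g _ * _ ^+ 2 <= _); ring.
Qed.

(** The point [b] has room [e] on both sides, but [v] may be an endpoint. The size
    [e / (1 + |x| + |z|)] keeps both moves within [e], which is at most half of [r - l]; the sign of
    [a] is chosen so that [v] moves towards the farther of [l] and [r]. *)
Let scaled_direction (l r v b e x z : R) : I l -> I r -> I v ->
  0 < e -> l + e <= b <= r - e -> exists2 a : R, a != 0 &
    I (v + a * x) /\ I (b + a * z).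
Proof.
move=> Il Ir Iv e0 bE.
set N := 1 + `|x| + `|z|.
have x0 := normr_ge0 x; have z0 := normr_ge0 z.
have N0 : 0 < N by rewrite /N; lra.
set a := e / N; have a0 : 0 < a by rewrite divr_gt0.
have aN : a * N = e by rewrite /a divfK ?gt_eqF.
have ax : `|a * x| <= e.
  by rewrite normrM (gtr0_norm a0) -aN ler_pM2l// /N; lra.
have az : `|a * z| <= e.
  by rewrite normrM (gtr0_norm a0) -aN ler_pM2l// /N; lra.
move: ax az; rewrite !ler_norml => ax az.
have Ib c : `|c| <= e -> I (b + c).
  by rewrite ler_norml => ce; apply: (I_itv _ _ Il Ir); lra.
have [vm|mv] := leP v ((l + r) / 2); have [x_ge0|x_lt0] := leP 0 (a * x).
- exists a; first by rewrite gt_eqF.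
  split; first by apply: (I_itv _ _ Iv Ir); lra.
  by apply: (I_itv _ _ Il Ir); lra.
- exists (- a); first by rewrite oppr_eq0 gt_eqF.
  split; first by apply: (I_itv _ _ Iv Ir); lra.
  by apply: (I_itv _ _ Il Ir); lra.
- exists (- a); first by rewrite oppr_eq0 gt_eqF.
  split; first by apply: (I_itv _ _ Il Iv); lra.
  by apply: (I_itv _ _ Il Ir); lra.
- exists a; first by rewrite gt_eqF.
  split; first by apply: (I_itv _ _ Il Iv); lra.
  by apply: (I_itv _ _ Il Ir); lra.
Qed.

(* Convexity on [I * I] only bounds the Hessian in directions that stay in
   [I * I]; the form is homogeneous in [(x, y)] and in [(b, y)], which reaches
   all the others. *)
Lemma hessian_form_ge0 (l r : R) : I l -> I r -> l < r ->
  forall v x b y, I v ->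
  0 <= g2 v * x ^+ 2 * b ^+ 2 + 4 * (g1 v * x * b * y) + 2 * (g v * y ^+ 2).
Proof.
move=> Il Ir lr v x b y Iv.
(* The base point must be interior, to move both ways, and nonzero, to be rescaled to any [b != 0].
   The midpoint serves unless it is 0; then a point halfway from it to [r] does. *)
have [b0 [e [b0_neq0 e0 b0E]]] :
    exists b0 e : R, [/\ b0 != 0, 0 < e & l + e <= b0 <= r - e].
  have [lr0|lr0] := eqVneq (l + r) 0.
    exists ((r - l) / 4), ((r - l) / 4).
    by split; [rewrite gt_eqF//; lra|lra|lra].
  exists ((l + r) / 2), ((r - l) / 4).
  by split; [rewrite mulf_neq0// invr_eq0|lra|lra].
have base z : 0 <= g2 v * x ^+ 2 * b0 ^+ 2 + 4 * (g1 v * x * b0 * z) +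
    2 * (g v * z ^+ 2).
  have [a a0 [Iva Iba]] := scaled_direction _ _ _ _ _ x z Il Ir Iv e0 b0E.
  have Ib0 : I b0 by apply: (I_itv _ _ Il Ir); lra.
  have := form2_ge0 _ _ _ _ Iv Iva Ib0 Iba.
  rewrite /form2 !mul0r !addr0.
  set A := (X in 0 <= X); set B := (X in _ -> 0 <= X).
  have -> : A = a ^+ 2 * B by rewrite /A /B; ring.
  by rewrite pmulr_rge0// exprn_even_gt0.
(* With the first coordinate fixed and the second moved by [e], only [2 * (g v * e ^+ 2)] survives.
   This settles the case [b = 0]. *)
have gv0 : 0 <= g v.
  have Ib0 : I b0 by apply: (I_itv _ _ Il Ir); lra.
  have Ib1 : I (b0 + e) by apply: (I_itv _ _ Il Ir); lra.
  have := form2_ge0 _ _ _ _ Iv Iv Ib0 Ib1.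
  rewrite /form2 !mul0r !addr0 subrr (addrC b0) addrK.
  have e2 : 0 < e ^+ 2 by rewrite exprn_gt0.
  rewrite expr0n/= !(mulr0, mul0r, add0r) pmulr_rge0//.
  by rewrite pmulr_lge0.
have [->|b_neq0] := eqVneq b 0.
  by rewrite expr0n/= !(mulr0, mul0r, add0r) mulr_ge0// mulr_ge0// sqr_ge0.
(* Homogeneity in [(b, y)]: the factor [b0 / b] takes [b] to [b0] and [y] to [y * b0 / b]. *)
have := base (y * b0 / b).
set A := (X in 0 <= X); set B := (X in _ -> 0 <= X).
have -> : A = (b0 / b) ^+ 2 * B by rewrite /A /B; field.
by rewrite pmulr_rge0// exprn_even_gt0//= mulf_neq0// invr_eq0.
Qed.

(** The right-hand side is the gap at [(u, a)] between [g u * a ^+ 2] and its tangent plane at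
    [(v, b)]. Here [a] and [b] are arbitrary reals, since they will be increments;
    [hessian_form_ge0] permits this. *)
Lemma form_tangent (l r : R) : I l -> I r -> l < r ->
  forall u v a b, I u -> I v ->
  0 <= a ^+ 2 * g u - 2 * (a * b * g v) +
       b ^+ 2 * (g v - g1 v * (u - v)).
Proof.
move=> Il Ir lr u v a b Iu Iv.
have : g (v + 0 * (u - v)) * ((b + 0 * (a - b)) * (b + 0 * (a - b))) +
    form1 v u b (a - b) 0 <=
    g (v + 1 * (u - v)) * ((b + 1 * (a - b)) * (b + 1 * (a - b))).
  apply: (tangent_below
    (fun t => g (v + t * (u - v)) * ((b + t * (a - b)) * (b + t * (a - b))))
    (form1 v u b (a - b)) (form2 v u b (a - b))) => t t01.
  - exact: form_derive1.
  - exact: form_derive2.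
  - rewrite /form2 -!mulrA.
    have := hessian_form_ge0 _ _ Il Ir lr (v + t * (u - v)) (u - v)
      (b + t * (a - b)) (a - b) (interval_affine Iv Iu t01).
    by rewrite -!mulrA.
rewrite /form1 !mul0r !mul1r !addr0 !(addrC v) subrK !(addrC b) subrK.
lra.
Qed.

Context (f f1 : R -> R)
  (ff1 : forall u, I u -> has_derive_in I f u (f1 u))
  (f1g : forall u, I u -> has_derive_in I f1 u (g u)).

(* The gradient of [D u v = f u - f v - f1 v * (u - v)] is
   [(f1 u - f1 v, - g v * (u - v))]. *)
Lemma bregman_tangent (u v p q : R) : I u -> I v -> I p -> I q ->
  f p - f q - f1 q * (p - q) + (f1 p - f1 q) * (u - p) -
    g q * (p - q) * (v - q) <= f u - f v - f1 v * (u - v).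
Proof.
move=> Iu Iv Ip Iq.
(* If [I] has at most one point, derivatives carry no information, but then both sides vanish. *)
have [[l [r [Il Ir lr]]]|Ieq] := pselect (exists l r, [/\ I l, I r & l < r]);
  last first.
  have Ieq' a b : I a -> I b -> a = b.
    move=> Ia Ib; have [ab|ba|//] := ltgtP a b; case: Ieq.
      by exists a, b.
    by exists b, a.
  by rewrite (Ieq' u q)// (Ieq' v q)// (Ieq' p q)//; lra.
set x := u - p; set y := v - q.
(* [h] is [D] along the segment from [(p, q)] to [(u, v)]; the claim is that its tangent at 0 lies
   below it at 1. *)
pose h t := f (p + t * x) + (- f (q + t * y) +
  - (f1 (q + t * y) * ((p - q) + t * (x - y)))).
pose h' t := f1 (p + t * x) * x + (- (f1 (q + t * y) * y) +
  - (g (q + t * y) * y * ((p - q) + t * (x - y)) +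
     f1 (q + t * y) * (x - y))).
pose h'' t := g (p + t * x) * x * x + (- (g (q + t * y) * y * y) +
  - (g1 (q + t * y) * y * y * ((p - q) + t * (x - y)) +
    g (q + t * y) * y * (x - y) + g (q + t * y) * y * (x - y))).
have : h 0 + h' 0 <= h 1.
  apply: (tangent_below h h' h'') => t t01.
  - apply: has_derive_inD (comp_derive ff1 Ip Iu t01) _.
    apply: has_derive_inD; apply: has_derive_inN.
      exact: comp_derive.
    apply: has_derive_inM (comp_derive f1g Iq Iv t01) _.
    exact: has_derive_in_affine.
  - apply: has_derive_in_eq.
      apply: has_derive_inD.
        apply: has_derive_inM (comp_derive f1g Ip Iu t01) _.
        exact: has_derive_in_cst.
      apply: has_derive_inD; apply: has_derive_inN.
        apply: has_derive_inM (comp_derive f1g Iq Iv t01) _.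
        exact: has_derive_in_cst.
      apply: has_derive_inD.
        apply: has_derive_inM; last exact: has_derive_in_affine.
        apply: has_derive_inM (comp_derive gg1 Iq Iv t01) _.
        exact: has_derive_in_cst.
      apply: has_derive_inM (comp_derive f1g Iq Iv t01) _.
      exact: has_derive_in_cst.
    by rewrite /h'' -/x -/y; ring.
  (* The second derivative is exactly the tangent gap of the form at the current point, with the
     increments [x] and [y] as second coordinates. *)
  - have := form_tangent _ _ Il Ir lr (p + t * x) (q + t * y) x y
      (interval_affine Ip Iu t01) (interval_affine Iq Iv t01).
    rewrite /h''; set A := (X in 0 <= X); set B := (X in _ -> 0 <= X).
    by have -> : A = B by rewrite /A /B; ring.
rewrite /h /h' !mul0r !addr0 !mul1r /x /y !(addrC p) !(addrC q) !subrK.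
lra.
Qed.

End bregman.

(** * Integrals and partial means *)

Section integral_complements.
Context {disp : measure_display} {T : measurableType disp} {R : realType}.
Variable P : probability T R.

(** The integral of [B] may be infinite. Then the negative part of [B + L] is still dominated by
    that of [L], while [B <= (B + L)^+ + |L|] forces the positive part to have infinite integral. *)
Lemma ge0_integralD_integrable (B L : T -> R) :
  measurable_fun setT B -> (forall x, 0 <= B x) ->
  P.-integrable setT (EFin \o L) ->
  (\int[P]_x (B x + L x)%:E = \int[P]_x (B x)%:E + \int[P]_x (L x)%:E)%E.
Proof.
move=> mB B0 iL; have mL : measurable_fun setT L.
  exact/measurable_EFinP/(measurable_int P).
have mBE : measurable_fun setT (EFin \o B) by exact/measurable_EFinP.
have [Boo|] := ltP (\int[P]_x (B x)%:E)%E +oo%E.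
  have iB : P.-integrable setT (EFin \o B).
    apply/integrableP; split => //; apply: le_lt_trans Boo.
    rewrite le_eqVlt (eq_integral (EFin \o B)) ?eqxx// => x _ /=.
    by rewrite ger0_norm.
  exact: integralD_EFin.
rewrite leye_eq => /eqP Boo; rewrite Boo.
have /fineK <- := integrable_fin_num measurableT iL.
rewrite addye//.
pose h x := (B x + L x)%:E.
have mh : measurable_fun setT h by exact/measurable_EFinP/measurable_funD.
rewrite -[LHS]/(\int[P]_x h x)%E integralE.
have hneg : (\int[P]_x (h^\- x) < +oo)%E.
  apply: le_lt_trans (integral_funeneg_lt_pinfty measurableT iL).
  apply: ge0_le_integral => //.
  - exact: measurable_funeneg.
  - by apply: measurable_funeneg; exact/measurable_EFinP.
  - move=> x _; rewrite /h !funenegE /= -!EFin_max lee_fin.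
    by rewrite ge_max !le_max lerN2 lexx orbT andbT lerDr B0.
have -> : (\int[P]_x (h^\+ x) = +oo)%E.
  have iL' := integrable_abse iL.
  apply/eqP; rewrite -leye_eq leNgt; apply/negP => hpos.
  have : (\int[P]_x (B x)%:E < +oo)%E; last by rewrite Boo ltxx.
  apply: (@le_lt_trans _ _ (\int[P]_x (h^\+ x + `|(L x)%:E|))%E).
    apply: ge0_le_integral => //.
    - by move=> x _; rewrite lee_fin.
    - apply: emeasurable_funD; first exact: measurable_funepos.
      by apply: measurableT_comp => //; exact/measurable_EFinP.
    - move=> x _; rewrite /h funeposE /= -EFin_max -EFinD lee_fin.
      have := ler_norm (- L x); rewrite normrN.
      have : B x + L x <= Num.max (B x + L x) 0 by rewrite le_max lexx.
      lra.
  rewrite ge0_integralD//.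
  - rewrite lte_add_pinfty//; by case/integrableP : iL.
  - exact: measurable_funepos.
  - by apply: measurableT_comp => //; exact/measurable_EFinP.
by rewrite addye// eqe_oppLR/= lt_eqF.
Qed.

Lemma integral_affine (f k : T -> R) (a b c : R) :
  P.-integrable setT (EFin \o f) -> P.-integrable setT (EFin \o k) ->
  P.-integrable setT (EFin \o (fun x => c + (a * f x + b * k x))) /\
  (\int[P]_x (c + (a * f x + b * k x))%:E =
    (c + (a * (\int[P]_x f x)%R + b * (\int[P]_x k x)%R))%:E)%E.
Proof.
move=> intf intk.
have iaf : P.-integrable setT (EFin \o (fun x => a * f x)).
  exact: (integrableZl measurableT a intf).
have ibk : P.-integrable setT (EFin \o (fun x => b * k x)).
  exact: (integrableZl measurableT b intk).
have iab : P.-integrable setT (EFin \o (fun x => a * f x + b * k x)).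
  exact: (integrableD measurableT iaf ibk).
have ic : P.-integrable setT (EFin \o cst c).
  exact: finite_measure_integrable_cst.
have iabc : P.-integrable setT (EFin \o (fun x => c + (a * f x + b * k x))).
  exact: (integrableD measurableT ic iab).
split => //; rewrite -[LHS]fineK; last exact: integrable_fin_num.
congr EFin; rewrite -[LHS]/(\int[P]_x (c + (a * f x + b * k x))).
rewrite RintegralD// RintegralD// RintegralZl// RintegralZl//.
by rewrite Rintegral_cst//= probability_setT mulr1.
Qed.

(** If the mean [m] were outside the closed set [I], a ball of radius [e] around it would miss [I].
    Being an interval, [I] would lie on one side of that ball, and so would the mean. *)
Lemma mean_in_interval (I : set R) (f : T -> R) :
  is_interval I -> closed I -> (forall x, I (f x)) ->
  P.-integrable setT (EFin \o f) -> I (\int[P]_x f x).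
Proof.
move=> I_itv I_closed If intf; apply: contrapT => nI.
set m := (X in I X) in nI.
have Pcst (r : R) : \int[P]_x (cst r x) = r.
  by rewrite Rintegral_cst//= probability_setT mulr1.
have icst (r : R) : P.-integrable setT (EFin \o cst r).
  exact: finite_measure_integrable_cst.
have /nbhs_ballP[e /= e0 He] : nbhs m (~` I).
  by apply: open_nbhs_nbhs; split => //; exact: closed_openC.
have far y : I y -> (y <= m - e) || (m + e <= y).
  move=> Iy; apply/negPn/negP; rewrite negb_or -!ltNge => /andP[ly yl].
  by apply: (He y) => //; rewrite -ball_normE/= ltr_norml; lra.
have [[y Iy ym]|Ige] := pselect (exists2 y, I y & y < m).
  have : m <= m - e; last by lra.
  rewrite -[leRHS]Pcst; apply: le_Rintegral => // x _ /=.
  have /orP[//|mex] := far _ (If x).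
  by case: nI; apply: (I_itv _ _ Iy (If x)); lra.
have : m + e <= m; last by lra.
rewrite -[leLHS]Pcst; apply: le_Rintegral => // x _ /=.
have /orP[xm|//] := far _ (If x).
by case: Ige; exists (f x) => //; lra.
Qed.

End integral_complements.

Section section_mean.
Context {d1 d2 : measure_display} {X : measurableType d1}
  {Y : measurableType d2} {R : realType}.
Variables (P : probability X R) (Q : probability Y R).

(** The partial mean makes sense only for almost every [y]; this version is measurable and takes
    values in [I] everywhere. *)
Lemma section_mean (I : set R) (F : X * Y -> R) :
  is_interval I -> closed I -> (forall z, I (F z)) ->
  (P \x Q)%E.-integrable setT (EFin \o F) ->
  exists m : Y -> R, [/\ measurable_fun setT m, forall y, I (m y),
    forall y, P.-integrable setT (EFin \o (fun x => F (x, y))) ->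
      m y = \int[P]_x F (x, y),
    Q.-integrable setT (EFin \o m) &
    \int[Q]_y m y = \int[(P \x Q)%E]_z F z].
Proof.
move=> I_itv I_closed IF iF.
have mF : measurable_fun setT (EFin \o F) := measurable_int _ iF.
pose A := [set y | (\int[P]_x `|(F (x, y))%:E| < +oo)%E].
have mG : measurable_fun setT (fun y => (\int[P]_x `|(F (x, y))%:E|)%E).
  apply: (measurable_fun_fubini_tonelli_G (abse \o (EFin \o F))) => //=.
  exact: measurableT_comp.
have mA : measurable A.
  by rewrite -[A]setTI; exact: emeasurable_fun_infty_o.
have AP y : A y <-> P.-integrable setT (EFin \o (fun x => F (x, y))).
  split => [Ay|/integrableP[]//]; apply/integrableP; split => //.
  exact: (measurable_fun_pair1 y mF).
(* Where the section is not integrable, [F point] serves as some value in [I]. *)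
pose m y := if y \in A then \int[P]_x F (x, y) else F point.
exists m.
have mm : measurable_fun setT m.
  apply: measurable_fun_ifT.
  - apply: (measurable_fun_bool true); rewrite setTI.
    rewrite (_ : _ @^-1` _ = A)//.
    by apply/seteqP; split=> [y /set_mem|y /mem_set].
  - apply: measurableT_comp; first exact: fine_measurable.
    exact: (measurable_fubini_G iF).
  - exact: measurable_cst.
have mE y : P.-integrable setT (EFin \o (fun x => F (x, y))) ->
    m y = \int[P]_x F (x, y).
  by move=> /AP Ay; rewrite /m mem_set.
have aeG : ae_eq Q setT (fubini_G P (EFin \o F)) (EFin \o m).
  apply: filterS (ae_integrable2 iF) => y iy _ /=.
  by rewrite mE// /Rintegral fineK//; exact: integrable_fin_num.
have im : Q.-integrable setT (EFin \o m).
  have mm' : measurable_fun setT (EFin \o m) by exact/measurable_EFinP.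
  apply/integrableP; split => //.
  have [/(_ iF) iF' _] := integrable21ltyP P Q mF.
  apply: le_lt_trans iF'.
  apply: ae_ge0_le_integral => //.
  - exact: measurableT_comp.
  - by move=> y _; exact: integral_ge0.
  - apply: filterS (ae_integrable2 iF) => y iy _.
    rewrite -[leLHS]/(`|(m y)%:E|%E) mE// /Rintegral fineK.
      by apply: le_abse_integral => //; exact: (measurable_int P).
    exact: integrable_fin_num.
split => //.
- move=> y; rewrite /m; case: ifPn => [/set_mem/AP iy|_]; last exact: IF.
  by apply: mean_in_interval => // x; exact: IF.
- rewrite /Rintegral -(integral21_prod_meas1 iF); congr fine.
  apply: ae_eq_integral => //.
  - exact/measurable_EFinP.
  - exact: (measurable_fubini_G iF).
  - exact: ae_eq_sym.
Qed.

End section_mean.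

(** * Subadditivity of the entropy *)

Section product_swap.
Context {d1 d2 : measure_display} {X : measurableType d1}
  {Y : measurableType d2} {R : realType}.
Variables (P : probability X R) (Q : probability Y R).

(** With [Rintegral_swap], this lets [section_mean] provide the means over the second variable
    too. *)
Lemma integrable_swap (F : X * Y -> R) :
  (P \x Q)%E.-integrable setT (EFin \o F) ->
  (Q \x P)%E.-integrable setT (EFin \o (F \o swap_pair)).
Proof.
move=> iF; have mF : measurable_fun setT (EFin \o F) := measurable_int _ iF.
have mFs : measurable_fun setT (EFin \o (F \o swap_pair)).
  by apply: (measurableT_comp mF); exact: measurable_fun_pair.
have [/(_ iF) iF' _] := integrable12ltyP P Q mF.
by have [_] := integrable21ltyP Q P mFs; apply.
Qed.

Lemma Rintegral_swap (F : X * Y -> R) :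
  (P \x Q)%E.-integrable setT (EFin \o F) ->
  \int[(Q \x P)%E]_z (F \o swap_pair) z = \int[(P \x Q)%E]_z F z.
Proof.
move=> iF; have iFs := integrable_swap F iF.
rewrite /Rintegral; congr fine.
have E1 := integral12_prod_meas1 iF.
have E2 := integral21_prod_meas1 iFs.
by rewrite -[LHS]E2 -[RHS]E1.
Qed.

End product_swap.

Section entropy.
Context {R : realType} (I : set R).
Context (I_itv : is_interval I) (I_closed : closed I).
Context (f f1 g : R -> R).
Hypothesis mf : measurable_fun I f.
Hypothesis mf1 : measurable_fun I f1.

Let D (u v : R) : R := f u - f v - f1 v * (u - v).

Hypothesis D_tangent : forall u v p q, I u -> I v -> I p -> I q ->
  D p q + (f1 p - f1 q) * (u - p) - g q * (p - q) * (v - q) <= D u v.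

(** The tangent plane of [D] at the diagonal point [(v, v)] is zero. *)
Let D_ge0 u v : I u -> I v -> 0 <= D u v.
Proof.
by move=> Iu Iv; have := D_tangent _ _ _ _ Iu Iv Iv Iv; rewrite /D; lra.
Qed.

Let measurable_in {disp} {T : measurableType disp} (h : R -> R) (k : T -> R) :
  measurable_fun I h -> measurable_fun setT k -> (forall x, I (k x)) ->
  measurable_fun setT (fun x => h (k x)).
Proof.
move=> mh mk Ik; apply: (measurable_comp (F := I)) => //.
- exact: is_interval_measurable.
- by move=> _ [x _ <-].
Qed.

Let measurable_D {disp} {T : measurableType disp} (h k : T -> R) :
  measurable_fun setT h -> measurable_fun setT k ->
  (forall x, I (h x)) -> (forall x, I (k x)) ->
  measurable_fun setT (fun x => (D (h x) (k x))%:E).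
Proof.
move=> mh mk Ih Ik; apply/measurable_EFinP.
apply: measurable_funB; first by apply: measurable_funB; exact: measurable_in.
by apply: measurable_funM; [exact: measurable_in|exact: measurable_funB].
Qed.

Section one_measure.
Context {disp : measure_display} {T : measurableType disp}.
Variables (P : probability T R) (h : T -> R).
Hypotheses (Ih : forall x, I (h x)) (ih : P.-integrable setT (EFin \o h)).

Let mh : measurable_fun setT h.
Proof. exact/measurable_EFinP/(measurable_int P). Qed.

Let m := \int[P]_x h x.

Let Im : I m.
Proof. exact: mean_in_interval. Qed.

(** Three-point identity: [D u v = D u m + D m v + (f1 m - f1 v) * (u - m)], and the last term has
    mean zero at [u = h x]. *)
Lemma integral_bregman v : I v ->
  (\int[P]_x (D (h x) v)%:E = \int[P]_x (D (h x) m)%:E + (D m v)%:E)%E.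
Proof.
move=> Iv.
(* The term [0 * h x] only gives [L] the two-function shape of [integral_affine]. *)
pose L x := D m v - (f1 m - f1 v) * m + ((f1 m - f1 v) * h x + 0 * h x).
have [iL LE] := integral_affine P _ _ (f1 m - f1 v) 0
  (D m v - (f1 m - f1 v) * m) ih ih.
rewrite (eq_integral (fun x => (D (h x) m + L x)%:E)); last first.
  by move=> x _; congr EFin; rewrite /L /D; ring.
rewrite ge0_integralD_integrable//.
- by congr (_ + _)%E; rewrite LE -/m; congr EFin; ring.
- by apply/measurable_EFinP; exact: measurable_D.
- by move=> x; exact: D_ge0.
Qed.

(** [D (h x) m] is [f (h x)] minus the tangent line of [f] at [m], whose mean is [f m]. Entropy thus
    becomes the integral of a nonnegative function, open to Tonelli's theorem even when infinite. *)
Lemma entropy_bregman :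
  entropy f P h = (\int[P]_x (D (h x) m)%:E)%E.
Proof.
pose L x := f m - f1 m * m + (f1 m * h x + 0 * h x).
have [iL LE] := integral_affine P _ _ (f1 m) 0 (f m - f1 m * m) ih ih.
rewrite /entropy -/m (eq_integral (fun x => (D (h x) m + L x)%:E)); last first.
  by move=> x _; congr EFin; rewrite /L /D; ring.
rewrite ge0_integralD_integrable//.
- rewrite LE -/m (_ : _ + _ = f m); last by ring.
  by rewrite addeK.
- by apply/measurable_EFinP; exact: measurable_D.
- by move=> x; exact: D_ge0.
Qed.

(** [L] is the tangent plane of [D] at the pair of means, evaluated at [(h x, k x)]; it lies below
    [D] and integrates to [D] at the means. *)
Lemma jensen_bregman (k : T -> R) : (forall x, I (k x)) ->
  P.-integrable setT (EFin \o k) ->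
  ((D m (\int[P]_x k x)%R)%:E <= \int[P]_x (D (h x) (k x))%:E)%E.
Proof.
move=> Ik ik; have mk : measurable_fun setT k.
  exact/measurable_EFinP/(measurable_int P).
set q := \int[P]_x k x; have Iq : I q by exact: mean_in_interval.
set a := f1 m - f1 q; set b := - (g q * (m - q)).
pose L x := D m q - a * m - b * q + (a * h x + b * k x).
have [iL LE] := integral_affine P _ _ a b (D m q - a * m - b * q) ih ik.
have LD x : L x <= D (h x) (k x).
  apply: le_trans (D_tangent _ _ _ _ (Ih x) (Ik x) Im Iq).
  by rewrite /L /a /b le_eqVlt; apply/orP; left; apply/eqP; ring.
rewrite (eq_integral (fun x => ((D (h x) (k x) - L x) + L x)%:E)); last first.
  by move=> x _; rewrite subrK.
rewrite ge0_integralD_integrable//.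
- rewrite LE -/m -/q (_ : _ + _ = D m q); last by ring.
  rewrite leeDr//; apply: integral_ge0 => x _.
  by rewrite lee_fin subr_ge0.
- apply: measurable_funB; last exact/measurable_EFinP/(measurable_int P).
  by apply/measurable_EFinP; exact: measurable_D.
- by move=> x; rewrite subr_ge0.
Qed.

End one_measure.

Lemma entropy_product {d1 d2 : measure_display} {X : measurableType d1}
    {Y : measurableType d2} (P : probability X R) (Q : probability Y R)
    (F : X * Y -> R) (a1 : Y -> \bar R) (a2 : X -> \bar R) :
  (forall z, I (F z)) -> (P \x Q)%E.-integrable setT (EFin \o F) ->
  measurable_fun setT a1 -> (forall y, 0 <= a1 y)%E ->
  measurable_fun setT a2 -> (forall x, 0 <= a2 x)%E ->
  (forall y, P.-integrable setT (EFin \o (fun x => F (x, y))) ->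
    entropy f P (fun x => F (x, y)) <= a1 y)%E ->
  (forall x, Q.-integrable setT (EFin \o (fun y => F (x, y))) ->
    entropy f Q (fun y => F (x, y)) <= a2 x)%E ->
  (entropy f (P \x Q)%E F <= \int[Q]_y a1 y + \int[P]_x a2 x)%E.
Proof.
move=> IF iF ma1 a1_ge0 ma2 a2_ge0 ent1 ent2.
have mF : measurable_fun setT F.
  by apply/measurable_EFinP; exact: measurable_int iF.
have [m [mm Im mE im meanm]] := section_mean P Q I F I_itv I_closed IF iF.
have iFs := integrable_swap P Q F iF.
have [k [mk Ik kE ik meank]] :=
  section_mean Q P I (F \o swap_pair) I_itv I_closed
    (fun z => IF (swap_pair z)) iFs.
rewrite Rintegral_swap// in meank.
pose M := \int[(P \x Q)%E]_z F z.
have {}meanm : \int[Q]_y m y = M := meanm.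
have {}meank : \int[P]_x k x = M := meank.
have IM : I M by exact: mean_in_interval.
have mD1 : measurable_fun setT (fun z : X * Y => (D (F z) M)%:E).
  by apply: measurable_D.
have mD2 : measurable_fun setT (fun z : X * Y => (D (F z) (k z.1))%:E).
  by apply: measurable_D => //; exact: measurableT_comp.
have D0 u v : I u -> I v -> (0 <= (D u v)%:E)%E.
  by move=> Iu Iv; rewrite lee_fin; exact: D_ge0.
have aeP := ae_integrable2 iF; have aeQ := ae_integrable1 iF.
have D2_ge0 (z : X * Y) : (0 <= (D (F z) (k z.1))%:E)%E by exact: D0.
have D1_ge0 (z : X * Y) : (0 <= (D (F z) M)%:E)%E by exact: D0.
have E1 := fubini_tonelli2 (m1 := P) (m2 := Q) _ mD1 D1_ge0.
have -> : entropy f (P \x Q)%E F = (\int[Q]_y \int[P]_x (D (F (x, y)) M)%:E)%E.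
  by rewrite -[RHS]E1; exact: entropy_bregman.
(* For almost every [y] the inner integral splits into the entropy of [F (., y)] and [D (m y) M]. *)
apply: (@le_trans _ _ (\int[Q]_y (a1 y + (D (m y) M)%:E))%E).
  apply: ae_ge0_le_integral => //.
  - by move=> y _; apply: integral_ge0 => x _; exact: D0.
  - exact: (measurable_fun_fubini_tonelli_G _ mD1 D1_ge0).
  - by move=> y _; rewrite adde_ge0// D0.
  - by apply: emeasurable_funD => //; exact: measurable_D.
  - apply: filterS aeP => y iy _; rewrite /fubini_G.
    rewrite (integral_bregman P (fun x => F (x, y)))//.
    by rewrite -mE// leeD2r// mE// -entropy_bregman// ent1.
rewrite ge0_integralD//; last 2 first.
  by move=> y _; exact: D0.
  by exact: measurable_D.
rewrite leeD2l//.
(* Jensen in [x] for fixed [y]: the pair [(F (x, y), k x)] has mean [(m y, M)] for almost every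
   [y]. *)
apply: (@le_trans _ _ (\int[Q]_y \int[P]_x (D (F (x, y)) (k x))%:E)%E).
  apply: ae_ge0_le_integral => //.
  - by move=> y _; exact: D0.
  - exact: measurable_D.
  - by move=> y _; apply: integral_ge0 => x _; exact: D0.
  - exact: (measurable_fun_fubini_tonelli_G _ mD2 D2_ge0).
  - apply: filterS aeP => y iy _.
    by rewrite mE// -meank; exact: jensen_bregman.
(* After exchanging the integrals, the inner one over [y] is the entropy of [F (x, .)], because
   [k x] is its mean. *)
have E2 := fubini_tonelli (m1 := P) (m2 := Q) _ mD2 D2_ge0.
rewrite -[leLHS]E2.
apply: ae_ge0_le_integral => //.
- by move=> x _; apply: integral_ge0 => y _; exact: D0.
- exact: (measurable_fun_fubini_tonelli_F _ mD2 D2_ge0).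
- apply: filterS aeQ => x ix _ /=.
  have ix' : Q.-integrable setT (EFin \o (fun y => F (x, y))) by exact: ix.
  by rewrite kE// -entropy_bregman// ent2.
Qed.

(** The change of variables is applied to the nonnegative integrand [D (h y) m], so [f \o h] may
    fail to be integrable. *)
Lemma entropy_distribution {d1 d2 : measure_display} {X : measurableType d1}
    {Y : measurableType d2} (P : probability X R) (phi : {mfun X >-> Y})
    (h : Y -> R) : (forall y, I (h y)) -> measurable_fun setT h ->
  P.-integrable setT (EFin \o (h \o phi)) ->
  entropy f (distribution P phi) h = entropy f P (h \o phi).
Proof.
move=> Ih mh ih.
have mhE : measurable_fun setT (EFin \o h) by exact/measurable_EFinP.
have mean : \int[distribution P phi]_y h y = \int[P]_x (h \o phi) x.
  by congr fine; exact: integral_distribution mhE ih.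
have Iphi x : I ((h \o phi) x) by exact: Ih.
have Im : I (\int[P]_x (h \o phi) x).
  by exact: mean_in_interval.
rewrite !entropy_bregman//.
  rewrite mean ge0_integral_distribution//; first exact: measurable_D.
  by move=> y; rewrite lee_fin; exact: D_ge0.
exact: integrable_pushforward.
Qed.

End entropy.

(** * Translations and convolutions *)

Section smooth_functions.
Context {R : realType} {d : nat}.
Implicit Types (f : 'rV[R]_d -> R) (x : 'rV[R]_d).

Lemma continuous_rV_measurable f : continuous f -> measurable_fun setT f.
Proof.
move=> /continuousP cf; apply: (measurability _ (RGenOpens.measurableE R)).
move=> _ [_ [a [b ->] <-]]; rewrite setTI; apply: open_measurable_rV.
exact/cf/interval_open.
Qed.

Lemma smooth_measurable f : smooth f -> measurable_fun setT f.
Proof. by move=> /(_ [::])[cf _]; exact: continuous_rV_measurable. Qed.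

Lemma difference_quotient_translate f x (y v : 'rV[R]_d) :
  (fun h : R =>
    h^-1 *: ((translate x f \o shift y) (h *: v) - translate x f y)) =
  (fun h => h^-1 *: ((f \o shift (x + y)) (h *: v) - f (x + y))).
Proof. by apply/funext => h; rewrite /translate /= addrCA. Qed.

Lemma smooth_translate f x : smooth f -> smooth (translate x f).
Proof.
move=> sf; have partialT s : foldr (@partial R d) (translate x f) s =
    translate x (foldr (@partial R d) f s).
  elim: s => //= i s ->; apply/funext => y.
  by rewrite /partial /derive difference_quotient_translate.
move=> s /=; have [cs ds] := sf s; rewrite partialT; split.
- move=> y; apply: (@continuous_comp _ _ _ (fun y => x + y)); last exact: cs.
  by apply: continuousD; [exact: cst_continuous|exact: cvg_id].
- by move=> i y; rewrite /derivable difference_quotient_translate; exact: ds.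
Qed.

End smooth_functions.

Lemma integrable_distribution {d1 d2 : measure_display}
    {X : measurableType d1} {Y : measurableType d2} {R : realType}
    (P : probability X R) (phi : {mfun X >-> Y}) (h : Y -> \bar R) :
  (distribution P phi).-integrable setT h -> P.-integrable setT (h \o phi).
Proof.
move=> /integrableP[mh hoo]; apply/integrableP; split.
  exact: measurableT_comp.
apply: le_lt_trans hoo; rewrite ge0_integral_distribution//.
exact: measurableT_comp.
Qed.

Theorem corollary13 (R : realType) (d n : nat)
    (I : set R) (I_itv : is_interval I) (I_closed : closed I)
    (Phi : R -> R) (Phi_smooth : smooth_in I Phi)
    (Phi_convex : @convex_function R R^o I Phi)
    (form_ge0 : forall p, (I `*` I) p -> 0 <= second_order_form I Phi p)
    (form_convex : @convex_function R (R^o * R^o)%type (I `*` I)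
       (second_order_form I Phi))
    (E : ('rV[R]_d -> R) -> 'rV[R]_d -> \bar R)
    (E_meas : forall f : 'rV[R]_d -> R, smooth f -> (forall y, I (f y)) ->
       measurable_fun setT (E f))
    (E_ge0 : forall f : 'rV[R]_d -> R, smooth f -> (forall y, I (f y)) ->
       forall y, (0 <= E f y)%E)
    (E_translate : forall f : 'rV[R]_d -> R, smooth f -> (forall y, I (f y)) ->
       forall x, E (translate x f) = translate x (E f))
    (mu : 'I_n -> probability 'rV[R]_d R)
    (c : 'I_n -> R) (c_gt0 : forall i, 0 < c i)
    (mu_ineq : forall (i : 'I_n) (f : 'rV[R]_d -> R),
       smooth f -> (forall y, I (f y)) ->
       (mu i).-integrable setT (EFin \o f) ->
       (entropy Phi (mu i) f <= (c i)%:E * \int[mu i]_y E f y)%E) :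
  forall f : 'rV[R]_d -> R,
    smooth f -> (forall y, I (f y)) ->
    (convolutions mu).-integrable setT (EFin \o f) ->
    (entropy Phi (convolutions mu) f
       <= (\sum_(i < n) c i)%:E * \int[convolutions mu]_y E f y)%E.
Proof.
have D k u (Iu : I u) := smooth_in_has_derive I Phi k u Phi_smooth Iu.
have form_convex' u v b a t : I u -> I v -> I b -> I a -> 0 <= t <= 1 ->
    iter 2 (derive_in I) Phi (t * u + (1 - t) * v) *
      (t * b + (1 - t) * a) ^+ 2 <=
    t * (iter 2 (derive_in I) Phi u * b ^+ 2) +
      (1 - t) * (iter 2 (derive_in I) Phi v * a ^+ 2).
  move=> Iu Iv Ib Ia /andP[t0 t1].
  by apply: (form_convex (Itv01 t0 t1) (u, b) (v, a)); rewrite inE.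
(* Here [g] is Phi'', and its two derivatives are the third and fourth derivatives of Phi. *)
have tangent := bregman_tangent I I_itv _ _ _ (D 2%N) (D 3%N) form_convex'
  _ _ (D 0%N) (D 1%N).
have measurable_iter k : measurable_fun I (iter k (derive_in I) Phi).
  apply: subspace_continuous_measurable_fun.
    exact: is_interval_measurable.
  exact: has_derive_in_continuous (D k).
(* Induction runs along the convolution and the sum of constants together. The bound [0 <= a] is
   kept to distribute [a + b] over a possibly infinite integral. *)
pose K (nu : probability 'rV[R]_d R) (a : R) := 0 <= a /\
  forall f : 'rV[R]_d -> R, smooth f -> (forall y, I (f y)) ->
    nu.-integrable setT (EFin \o f) ->
    (entropy Phi nu f <= a%:E * \int[nu]_y E f y)%E.
suff [] : K (convolutions mu) (\sum_(i < n) c i) by [].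
apply: (big_ind2 K) => [|P a Q b [a0 HP] [b0 HQ]|i _]; last first.
- by split; [exact: ltW|exact: mu_ineq].
- split=> [|f sf If intf]; first exact: addr_ge0.
  have mEf := E_meas f sf If; have Ef0 := E_ge0 f sf If.
  have mF : measurable_fun setT (E f \o @add_rV R d).
    exact: measurableT_comp.
  have F0 z : (0 <= (E f \o @add_rV R d) z)%E by exact: Ef0.
  have G0 y : (0 <= \int[P]_x (E f \o @add_rV R d) (x, y))%E.
    exact: integral_ge0.
  have H0 x : (0 <= \int[Q]_y (E f \o @add_rV R d) (x, y))%E.
    exact: integral_ge0.
  have mG := measurable_fun_fubini_tonelli_G (m1 := P) _ mF F0.
  have mH := measurable_fun_fubini_tonelli_F (m2 := Q) _ mF F0.
  have intF := integrable_distribution (P \x Q)%E add_rV _ intf.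
  have -> : entropy Phi (convolution P Q) f =
      entropy Phi (P \x Q)%E (f \o @add_rV R d).
    apply: (entropy_distribution I I_itv I_closed _ _ _ (measurable_iter 0%N)
      (measurable_iter 1%N) tangent) => //.
    exact: smooth_measurable.
  apply: (le_trans (entropy_product I I_itv I_closed _ _ _
    (measurable_iter 0%N) (measurable_iter 1%N) tangent P Q
    (f \o @add_rV R d)
    (fun y => a%:E * \int[P]_x (E f \o @add_rV R d) (x, y))%E
    (fun x => b%:E * \int[Q]_y (E f \o @add_rV R d) (x, y))%E
    (fun z => If _) intF _ _ _ _ _ _)).
  + exact: measurable_funeM.
  + by move=> y; rewrite mule_ge0.
  + exact: measurable_funeM.
  + by move=> x; rewrite mule_ge0.
  (* The sections of [f (x + y)] are translates of [f], and [E] commutes with translations. *)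
  + move=> y; have -> : (fun x => (f \o @add_rV R d) (x, y)) = translate y f.
      by apply/funext => x; rewrite /translate /add_rV /= addrC.
    move=> iy; apply: le_trans (HP _ (smooth_translate _ _ sf) _ iy) _.
      by move=> x; exact: If.
    rewrite E_translate// le_eqVlt; apply/orP; left; apply/eqP.
    congr (_ * _)%E; apply: eq_integral => x _.
    by rewrite /translate /add_rV /= addrC.
  + move=> x ix; apply: le_trans (HQ _ (smooth_translate _ x sf) _ ix) _.
      by move=> y; exact: If.
    by rewrite E_translate.
  (* By Tonelli, both iterated integrals equal the integral of [E f] against the convolution. *)
  rewrite ge0_integralZl// ge0_integralZl//.
  have E1 := fubini_tonelli1 (m1 := P) (m2 := Q) _ mF F0.
  have E2 := fubini_tonelli2 (m1 := P) (m2 := Q) _ mF F0.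
  rewrite -[X in (_ * X + _)%E]E2 -[X in (_ + _ * X)%E]E1.
  rewrite EFinD ge0_muleDl ?lee_fin//.
  have -> : (\int[convolution P Q]_y E f y =
      \int[(P \x Q)%E]_z (E f \o @add_rV R d) z)%E.
    exact: ge0_integral_distribution.
  by [].
(* Neutral element: the entropy under the Dirac mass at 0 is [Phi (f 0) - Phi (f 0)], and the
   constant is 0. *)
- split=> // f sf If intf.
  have mf := smooth_measurable f sf.
  have mPhif : measurable_fun setT (fun x => (Phi (f x))%:E).
    apply/measurable_EFinP; apply: (measurable_comp (F := I)) => //.
    + exact: is_interval_measurable.
    + by move=> _ [x _ <-].
    + exact: (measurable_iter 0%N).
  rewrite mul0e /entropy /Rintegral !integral_dirac//; last first.
    exact/measurable_EFinP.
  by rewrite diracT !mul1e /= subee.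
Qed.
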